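(* Let $\Lambda=\{\lambda_k\}_{k\in\mathbb{Z}}\subset\mathbb{R}$ be a countable set enumerated in strictly increasing order. Suppose that there exist $0<A\le B<\infty$ such that $$A\int_{[0,1]}|f(x)|^2\,dx\le\sum_{\lambda\in\Lambda}\Big|\int_{[0,1]}f(x)e^{-2\pi i\lambda x}\,dx\Big|^2\le B\int_{[0,1]}|f(x)|^2\,dx\qquad\text{for all } f\in L^2([0,1]).$$ Then $$\frac{4}{\pi^2B}\le g_{\max}(\Lambda)\le\sup\{g_k(\Lambda):k\in\mathbb{Z}\}\le\frac{\pi^2B}{A}+2.$$
   Context: For a set $\Lambda=\{\lambda_k\}_{k\in\mathbb{Z}}\subset\mathbb{R}$ with $\lambda_n<\lambda_m$ whenever $n<m$, the spectral gaps are $g_k(\Lambda):=\lambda_k-\lambda_{k-1}$, $k\in\mathbb{Z}$. The essential maximal spectral gap is $$g_{\max}(\Lambda):=\sup\{c\ge 0: g_k(\Lambda)>c\text{ for infinitely many }k\}.$$ *)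

(* Defs.v *)
From mathcomp Require Import all_boot all_order all_algebra.
From mathcomp Require Import all_classical all_reals all_analysis.
From mathcomp Require Export complex.

Set Implicit Arguments.
Unset Strict Implicit.
Unset Printing Implicit Defensive.

Import Order.TTheory GRing.Theory Num.Theory.
Import numFieldNormedType.Exports.

Local Open Scope classical_set_scope.
Local Open Scope ring_scope.

Section Complex_valued.
Context {R : realType}.

(* The norm of R[i] is R[i]-valued; [Normc.normc] is the R-valued modulus. *)
Definition cabs (z : R[i]) : R := Normc.normc z.

Definition cis (t : R) : R[i] := Complex (cos t) (sin t).

(* Only meaningful when Re f and Im f are integrable on D; this holds for
   the product of f in L^2([0, 1]) and a unimodular exponential. *)
Definition cintegral (D : set R) (f : R -> R[i]) : R[i] :=
  Complex (Rintegral (@lebesgue_measure R) D (fun x => complex.Re (f x)))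
          (Rintegral (@lebesgue_measure R) D (fun x => complex.Im (f x))).

Definition sqnorm2 (D : set R) (f : R -> R[i]) : \bar R :=
  (\int[@lebesgue_measure R]_(x in D) (cabs (f x) ^+ 2)%R%:E)%E.

(* Functions rather than a.e.-classes: every quantity built from f below is
   invariant under modification of f on a null set.  Measurability is Borel;
   every class in L^2 has a Borel representative. *)
Definition inL2 (D : set R) (f : R -> R[i]) : Prop :=
  [/\ measurable_fun D (fun x => complex.Re (f x)),
      measurable_fun D (fun x => complex.Im (f x)) &
      (sqnorm2 D f < +oo)%E].

Definition fourier_coeff (f : R -> R[i]) (l : R) : R[i] :=
  cintegral `[0, 1] (fun x => f x * cis (- (2 * pi * l * x))).

End Complex_valued.

Section Gaps.
Context {R : realType}.

Definition gap (lam : int -> R) (k : int) : R := lam k - lam (k - 1).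

(* Suprema are taken in the extended reals, so that no boundedness of the
   gaps is presupposed. *)
Definition gmax (lam : int -> R) : \bar R :=
  ereal_sup [set c%:E | c in
    [set c : R | 0 <= c /\ infinite_set [set k | c < gap lam k]]].

Definition gap_sup (lam : int -> R) : \bar R :=
  ereal_sup [set (gap lam k)%:E | k in [set: int]].

End Gaps.

(* Main.v *)
(** Testing the frame inequality on f(x) = exp(2 pi i m x) gives
    A <= sum_l sinc(pi (l - m))^2 <= B for every real m.
    Since sinc(pi t)^2 >= 4/pi^2 for |t| <= 1/2, the upper bound shows that a
    unit interval contains at most B pi^2 / 4 points of the spectrum.  If all gaps
    beyond some index were at most c < 4/(pi^2 B), then n consecutive points would
    fit in length c n, hence n <= (B pi^2 / 4) (c n + 1), which fails for large n.
    If a gap had length g > B/A + 2, take m to be its midpoint: bounding sinc^2 by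
    1/(pi t)^2 and grouping the points of each side in unit blocks gives
    A <= 2 (B/4) sum_j (g/2 + j)^-2 <= B/(g - 2), a contradiction. *)

Require Import Defs.
From mathcomp Require Import all_boot all_order all_algebra.
From mathcomp Require Import all_classical all_reals all_analysis measurable_realfun.
From mathcomp Require Import ring lra.
Import Order.TTheory GRing.Theory Num.Theory.
Import numFieldNormedType.Exports.

Local Open Scope classical_set_scope.
Local Open Scope ring_scope.

(** * Elementary inequalities: block sums and a lower bound for the sine *)

(** Cut [x, x + J) into unit blocks [x + j, x + j + 1). Each holds at most [C] of the points, and
    since [w] is nonincreasing each of these weighs at most w(x + j). The induction on [J] removes
    the last block. *)
Lemma sum_le_unit_blocks (R : realFieldType) (I : eqType) (w : R -> R)
    (q : I -> R) (C x : R) (J : nat) (s : seq I) :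
  (forall y (t : seq I), uniq t -> {in t, forall k, y <= q k <= y + 1} ->
     (size t)%:R <= C) ->
  (forall y, x <= y -> 0 <= w y) ->
  (forall y z, x <= y -> y <= z -> w z <= w y) ->
  uniq s -> {in s, forall k, x <= q k < x + J%:R} ->
  \sum_(k <- s) w (q k) <= C * \sum_(j < J) w (x + j%:R).
Proof.
move=> hC w0 wdec; elim: J s => [|J IH] s us hs.
  case: s us hs => [|k s] _ hs; first by rewrite big_nil big_ord0 mulr0.
  have := hs k (mem_head _ _); rewrite addr0 => /andP[h1 h2].
  by have := le_lt_trans h1 h2; rewrite ltxx.
rewrite (bigID (fun k => q k < x + J%:R)) big_ord_recr mulrDr /= lerD//.
  rewrite -big_filter IH ?filter_uniq// => k; rewrite mem_filter => /andP[h1].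
  by move=> /hs /andP[-> _].
rewrite -big_filter; set t := [seq k <- s | _].
have ht : {in t, forall k, x + J%:R <= q k <= x + J%:R + 1}.
  move=> k; rewrite mem_filter -leNgt => /andP[-> /hs /andP[_]].
  by rewrite -natr1 addrA => /ltW ->.
have xJ : x <= x + J%:R by rewrite lerDl.
apply: (@le_trans _ _ (\sum_(k <- t) w (x + J%:R))).
  rewrite big_seq [leRHS]big_seq ler_sum// => k /ht /andP[h _].
  exact: wdec.
rewrite big_const_seq count_predT iter_addr_0 -[_ *+ size t]mulr_natl ler_wpM2r ?w0//.
by apply: hC ht; rewrite filter_uniq.
Qed.

(** Telescoping: (x + j)^-2 <= 1/(x + j - 1) - 1/(x + j). *)
Lemma inv_sqr_sum_le (R : realFieldType) (x : R) (J : nat) : 1 < x ->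
  \sum_(j < J) (x + j%:R) ^- 2 <= (x - 1)^-1.
Proof.
move=> x1; suff : \sum_(j < J) (x + j%:R) ^- 2 <= (x - 1)^-1 - (x + J%:R - 1)^-1.
  move=> /le_trans; apply; rewrite gerDl oppr_le0 invr_ge0.
  by have := ler0n R J; lra.
elim: J => [|J IH]; first by rewrite big_ord0 addr0 subrr.
rewrite big_ord_recr/=; have := ler0n R J; move: IH.
rewrite -natr1; move: (\sum_(_ < _) _) (J%:R : R) => S y IH y0.
suff : (x + y) ^- 2 <= (x + y - 1)^-1 - (x + (y + 1) - 1)^-1 by lra.
have -> : x + (y + 1) - 1 = x + y by ring.
have -> : (x + y - 1)^-1 - (x + y)^-1 = ((x + y - 1) * (x + y))^-1.
  by field; apply/andP; split; apply: lt0r_neq0; lra.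
by rewrite lef_pV2 ?posrE; nra.
Qed.

(** Jordan's inequality, from the mean value theorem on [0, x] and on [x, pi/2]. *)
Lemma sin_ge_chord (R : realType) (x : R) :
  0 <= x <= pi / 2 -> 2 / pi * x <= sin x.
Proof.
move=> /andP[x0 xpi]; have p0 := @pi_gt0 R.
move: x0; rewrite le_eqVlt => /predU1P[<-|x0]; first by rewrite mulr0 sin0.
move: xpi; rewrite le_eqVlt => /predU1P[->|xpi].
  by rewrite sin_pihalf; have -> : 2 / pi * (pi / 2) = 1 :> R by field; lra.
have csin a b : {within `[a, b], continuous (@sin R)}.
  by apply: continuous_subspaceT; exact: continuous_sin.
have [c /[!in_itv]/= /andP[c0 cx]] := MVT x0 (fun y _ => is_derive_sin y) (csin _ _).
have [d /[!in_itv]/= /andP[dx dpi]] := MVT xpi (fun y _ => is_derive_sin y) (csin _ _).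
rewrite sin0 sin_pihalf !subr0 => e2 e1.
(* A value below the chord would force the slope to increase from c to d. *)
have cd : cos d < cos c.
  by rewrite ltr_cos ?in_itv/=; [lra|apply/andP; split; lra|apply/andP; split; lra].
have -> : 2 / pi * x = x / (pi / 2) by field; lra.
rewrite ler_pdivrMr ?divr_gt0//.
(* Adding the two mean value identities gives 1 = x cos c + (pi/2 - x) cos d, which is at most
   (pi/2) cos c. *)
have : 0 <= (cos c - cos d) * (pi / 2 - x) by rewrite mulr_ge0//; lra.
move: e1 e2; rewrite mulrBl => -> e2 h.
have : 1 <= cos c * (pi / 2) by lra.
by move=> /(ler_wpM2r (ltW x0)); rewrite mul1r mulrAC.
Qed.

(** * Integrals of cosine and sine over the unit interval *)

Lemma Rintegral_FTC2 (R : realType) (f F : R -> R) (a b : R) : a < b ->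
  continuous f -> (forall x : R, is_derive x 1 F (f x)) ->
  Rintegral (@lebesgue_measure R) `[a, b] f = F b - F a.
Proof.
move=> ab cf dF.
have cF : continuous F by move=> x; exact/differentiable_continuous/derivable1_diffP.
rewrite /Rintegral (@continuous_FTC2 _ f F)//.
- exact: continuous_subspaceT.
- split; first by move=> x _; case: (dF x).
  + by apply: cvg_at_right_filter; exact: cF.
  + by apply: cvg_at_left_filter; exact: cF.
- by move=> x _; rewrite derive1E; exact: derive_val.
Qed.

Lemma Rintegral_cos_unit (R : realType) (a : R) : a != 0 ->
  Rintegral (@lebesgue_measure R) `[0, 1] (fun x => cos (a * x)) = sin a / a.
Proof.
move=> a0.
have dF (x : R) : is_derive x 1 (fun x => sin (a * x) / a) (cos (a * x)).
  by apply: is_derive_eq; rewrite /GRing.scale/=; field.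
rewrite (@Rintegral_FTC2 _ _ _ _ _ ltr01 _ dF).
- by rewrite mulr1 mulr0 sin0 mul0r subr0.
- move=> x; apply: continuous_comp; last exact: continuous_cos.
  by apply: continuousM => //; exact: cst_continuous.
Qed.

Lemma Rintegral_sin_unit (R : realType) (a : R) : a != 0 ->
  Rintegral (@lebesgue_measure R) `[0, 1] (fun x => sin (a * x)) =
  (1 - cos a) / a.
Proof.
move=> a0.
have dF (x : R) : is_derive x 1 (fun x => - cos (a * x) / a) (sin (a * x)).
  by apply: is_derive_eq; rewrite /GRing.scale/=; field.
rewrite (@Rintegral_FTC2 _ _ _ _ _ ltr01 _ dF).
- by rewrite mulr1 mulr0 cos0; field.
- move=> x; apply: continuous_comp; last exact: continuous_sin.
  by apply: continuousM => //; exact: cst_continuous.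
Qed.

(** * Exponentials of real frequency as test functions *)

Definition expi {R : realType} (m x : R) : R[i] := cis (2 * pi * m * x).

Lemma sqr_cabs (R : realType) (z : R[i]) :
  cabs z ^+ 2 = complex.Re z ^+ 2 + complex.Im z ^+ 2.
Proof. by case: z => a b; rewrite /cabs/= sqr_sqrtr// addr_ge0 ?sqr_ge0. Qed.

Lemma sqr_cabs_cis (R : realType) (t : R) : cabs (cis t) ^+ 2 = 1.
Proof. by rewrite sqr_cabs cos2Dsin2. Qed.

Lemma sqnorm2_expi (R : realType) (m : R) : sqnorm2 `[0, 1] (expi m) = 1%E.
Proof.
rewrite /sqnorm2; under eq_integral do rewrite sqr_cabs_cis.
by rewrite integral_cst//= lebesgue_measure_itv/= lte_fin ltr01 sube0 mul1e.
Qed.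

Lemma inL2_expi (R : realType) (m : R) : inL2 `[0, 1] (expi m).
Proof.
split; last by rewrite sqnorm2_expi ltry.
- apply: subspace_continuous_measurable_fun => //.
  apply: continuous_subspaceT => x.
  apply: continuous_comp; last exact: continuous_cos.
  by apply: continuousM => //; exact: cst_continuous.
- apply: subspace_continuous_measurable_fun => //.
  apply: continuous_subspaceT => x.
  apply: continuous_comp; last exact: continuous_sin.
  by apply: continuousM => //; exact: cst_continuous.
Qed.

(** With a = 2 pi (m - l), the half-angle formulas turn the parts sin a / a and (1 - cos a) / a into
    2 s c / a and 2 s^2 / a, where s and c are taken at a/2; their squares add up to 4 s^2 / a^2.
    The case l = m is apart because there the quotient would read 0/0 = 0 instead of 1. *)
Lemma fourier_coeff_expi (R : realType) (m l : R) : l != m ->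
  cabs (fourier_coeff (expi m) l) ^+ 2 =
  (sin (pi * (l - m)) / (pi * (l - m))) ^+ 2.
Proof.
move=> lm; have p0 := @pi_gt0 R; set a := 2 * pi * (m - l).
have a0 : a != 0 by rewrite !mulf_neq0 ?subr_eq0 ?(eq_sym m)// lt0r_neq0//.
rewrite sqr_cabs/=.
have -> : (fun x => complex.Re (expi m x * cis (- (2 * pi * l * x)))) =
          (fun x => cos (a * x)).
  apply/funext => x /=; rewrite -cosD; congr cos; rewrite /a; ring.
have -> : (fun x => complex.Im (expi m x * cis (- (2 * pi * l * x)))) =
          (fun x => sin (a * x)).
  apply/funext => x /=; rewrite addrC -sinD; congr sin; rewrite /a; ring.
rewrite Rintegral_cos_unit// Rintegral_sin_unit//.
have -> : pi * (l - m) = - (a / 2) by rewrite /a; field.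
have := cos2Dsin2 (a / 2); rewrite sinN.
have -> : sin a = 2 * (sin (a / 2) * cos (a / 2)).
  by rewrite {1}[a](_ : _ = a / 2 *+ 2) ?sin_mulr2n; [ring|field].
have -> : cos a = 2 * cos (a / 2) ^+ 2 - 1.
  by rewrite {1}[a](_ : _ = a / 2 *+ 2) ?cos_mulr2n; [ring|field].
move: (cos _) (sin _) => c s cs.
have -> : 2 * c ^+ 2 - 1 = 1 - 2 * s ^+ 2 by lra.
transitivity (4 * s ^+ 2 * (c ^+ 2 + s ^+ 2) / a ^+ 2); first by field.
by rewrite cs; field.
Qed.

Lemma fourier_coeff_expi_id (R : realType) (m : R) :
  cabs (fourier_coeff (expi m) m) ^+ 2 = 1.
Proof.
rewrite sqr_cabs/=.
have -> : (fun x => complex.Re (expi m x * cis (- (2 * pi * m * x)))) = cst 1.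
  by apply/funext => x /=; rewrite -cosD subrr cos0.
have -> : (fun x => complex.Im (expi m x * cis (- (2 * pi * m * x)))) = cst 0.
  by apply/funext => x /=; rewrite addrC -sinD subrr sin0.
rewrite !Rintegral_cst//= lebesgue_measure_itv/= lte_fin ltr01 sube0.
by rewrite mul1r mul0r expr1n expr0n addr0.
Qed.

Lemma incr_int_inj (R : realType) (lam : int -> R) :
  (forall n m : int, n < m -> lam n < lam m) -> injective lam.
Proof.
move=> lam_incr n m e; by case: (ltgtP n m) => // /lam_incr; rewrite e ltxx.
Qed.

(** Strict monotonicity makes [lam] injective, so the sum over its range can be indexed by the
    integers. *)
Lemma frame_expi (R : realType) (lam : int -> R) (A B : R)
  (lam_incr : forall n m : int, n < m -> lam n < lam m)
  (frame : forall f : R -> R[i], inL2 `[0, 1] f ->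
     (A%:E * sqnorm2 `[0%R, 1%R] f
        <= \esum_(l in range lam) (cabs (fourier_coeff f l) ^+ 2)%R%:E)%E /\
     (\esum_(l in range lam) (cabs (fourier_coeff f l) ^+ 2)%R%:E
        <= B%:E * sqnorm2 `[0%R, 1%R] f)%E) (m : R) :
  (A%:E <= \esum_(k in [set: int])
    (cabs (fourier_coeff (expi m) (lam k)) ^+ 2)%R%:E <= B%:E)%E.
Proof.
have [] := frame _ (inL2_expi R m).
rewrite sqnorm2_expi !mule1 (reindex_esum [set: int] _ lam); first by move=> -> ->.
by split => // n k _ _; exact: incr_int_inj.
Qed.

Lemma fourier_coeff_expi_ge (R : realType) (m l : R) :
  m - 2^-1 <= l <= m + 2^-1 ->
  4 / pi ^+ 2 <= cabs (fourier_coeff (expi m) l) ^+ 2.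
Proof.
have p0 := @pi_gt0 R; move=> /andP[h1 h2].
have [->|lm] := eqVneq l m.
  rewrite fourier_coeff_expi_id ler_pdivrMr ?exprn_gt0// mul1r.
  by have := @pi_ge2 R; nra.
rewrite fourier_coeff_expi//.
(* The squared sinc is even and the condition |l - m| <= 1/2 is symmetric. *)
wlog ml : l m lm h1 h2 / m < l => [hw|].
  case: (ltgtP m l) => [|lt_lm|e]; first exact: hw; last by rewrite e eqxx in lm.
  have := hw m l _ _ _ lt_lm; rewrite eq_sym => /(_ lm).
  rewrite -(opprB l m) mulrN sinN invrN mulrNN; apply; lra.
have u0 : 0 < pi * (l - m) by rewrite mulr_gt0// subr_gt0.
have -> : 4 / pi ^+ 2 = (2 / pi) ^+ 2 :> R by field; lra.
have pi20 : 0 <= 2 / pi :> R by rewrite divr_ge0// ltW.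
have : 2 / pi <= sin (pi * (l - m)) / (pi * (l - m)).
  rewrite ler_pdivlMr// sin_ge_chord// ltW//=; nra.
move=> h; rewrite ler_pXn2r ?nnegrE//; exact: le_trans h.
Qed.

Lemma fourier_coeff_expi_le (R : realType) (m l : R) : l != m ->
  cabs (fourier_coeff (expi m) l) ^+ 2 <= pi ^- 2 * (l - m) ^- 2.
Proof.
move=> lm; rewrite fourier_coeff_expi// exprMn exprVn exprMn invfM.
by rewrite ler_piMl ?mulr_ge0 ?invr_ge0 ?sqr_ge0.
Qed.

(** * Bounds on the gaps from the inequality for exponentials *)

Section Gap_bounds.
Context {R : realType}.
Variables (lam : int -> R) (A B : R).
Hypothesis lam_incr : forall n m : int, n < m -> lam n < lam m.
Hypothesis frame : forall m : R, (A%:E <= \esum_(k in [set: int])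
    (cabs (fourier_coeff (expi m) (lam k)) ^+ 2)%R%:E <= B%:E)%E.

Lemma bessel_seq (m : R) (s : seq int) : uniq s ->
  \sum_(k <- s) cabs (fourier_coeff (expi m) (lam k)) ^+ 2 <= B.
Proof.
move=> us; have /andP[_] := frame m; rewrite -lee_fin; apply: le_trans.
apply: esum_ge; exists [set` s]; first by split => //; exact: finite_seq.
by rewrite -fsbig_seq// sumEFin.
Qed.

(** Test at the midpoint x + 1/2: every point of the interval contributes at least 4/pi^2 to a sum
    bounded by [B]. *)
Lemma card_unit_interval (x : R) (s : seq int) : uniq s ->
  {in s, forall k, x <= lam k <= x + 1} -> (size s)%:R <= B * pi ^+ 2 / 4.
Proof.
move=> us hs; have p0 : 0 < pi ^+ 2 :> R by rewrite exprn_gt0// pi_gt0.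
suff : (size s)%:R * (4 / pi ^+ 2) <= B.
  by rewrite ler_pdivlMr// mulrA ler_pdivrMr.
apply: le_trans (bessel_seq (x + 2^-1) s us).
rewrite mulr_natl -(iter_addr_0 (size s)) -(count_predT s) -big_const_seq.
rewrite big_seq [leRHS]big_seq ler_sum// => k /hs h.
by apply: fourier_coeff_expi_ge; lra.
Qed.

Lemma infinite_large_gaps (c : R) : 0 < B -> 0 <= c -> c < 4 / (pi ^+ 2 * B) ->
  infinite_set [set k | c < gap lam k].
Proof.
move=> B0 c0 cB fin.
have p0 : 0 < pi ^+ 2 :> R by rewrite exprn_gt0// pi_gt0.
(* The sum of |k| over the finitely many exceptional indices dominates each of them. *)
have [K hK] : exists K : int, forall k, K < k -> gap lam k <= c.
  have [s hs] := (finite_seqP _).1 fin.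
  exists (\sum_(k <- s) `|k|)%R => k; case: (leP (gap lam k) c) => // ck.
  have ks : [set` s] k by rewrite -hs.
  rewrite ltNge (big_rem k)//=.
  by rewrite (le_trans (ler_norm k))// lerDl sumr_ge0.
have lamK (n : nat) : lam (K + n%:Z) <= lam K + c * n%:R.
  elim: n => [|n IH]; first by rewrite mulr0 !addr0.
  have := hK (K + n.+1%:Z); rewrite /gap ltrDl => /(_ isT).
  have -> : K + n.+1%:Z - 1 = K + n%:Z by rewrite -addn1 PoszD; ring.
  by rewrite -natr1; lra.
set D := B * pi ^+ 2 / 4.
have D0 : 0 < D by rewrite divr_gt0// mulr_gt0.
have Dc : D * c < 1.
  by move: cB; rewrite ltr_pdivlMr; [rewrite /D; lra|exact: mulr_gt0].
have bound (n : nat) : n%:R <= D * (c * n%:R + 1).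
  pose s : seq int := [seq K + i%:Z | i <- iota 0 n].
  have us : uniq s.
    by rewrite map_inj_uniq ?iota_uniq// => i j /addrI [].
  (* The blocks are half-open, so their total length must strictly exceed c n; this [J] is still at
     most c n + 1. *)
  set J := (Num.truncn (c * n%:R)).+1.
  have cn : 0 <= c * n%:R by rewrite mulr_ge0.
  have /andP[J1 J2] : (Num.truncn (c * n%:R))%:R <= c * n%:R < J%:R.
    exact: truncn_itv.
  have hs : {in s, forall k, lam K <= lam k < lam K + J%:R}.
    apply/allP; rewrite all_map; apply/allP => i.
    rewrite mem_iota add0n => /andP[_ lt_in] /=; apply/andP; split.
      case: i lt_in => [|i] _; first by rewrite addr0.
      by apply/ltW/lam_incr; rewrite ltrDl.
    apply: (le_lt_trans (lamK i)); rewrite ltrD2l (le_lt_trans _ J2)//.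
    by rewrite ler_wpM2l// ler_nat ltnW.
  (* With constant weight 1 the block estimate counts points. *)
  have := @sum_le_unit_blocks R _ (fun=> 1) lam D (lam K) J s card_unit_interval
    (fun _ _ => ler01) (fun _ _ _ _ => lexx _) us hs.
  rewrite big_const_seq count_predT iter_addr_0 sumr_const card_ord.
  rewrite size_map size_iota => /le_trans; apply.
  by rewrite (ler_wpM2l (ltW D0))// /J -natr1 lerD2r.
(* The bound says n (1 - D c) <= D, which fails for n > D / (1 - D c). *)
have := bound (Num.truncn (D / (1 - D * c))).+1.
have := truncnS_gt (D / (1 - D * c)).
move: ((_.+1)%:R : R) => n; rewrite ltr_pdivrMr; last by lra.
by lra.
Qed.

(** The factor pi^2 of the block count cancels the pi^-2 of the decay estimate, so no pi is left in
    the bound. *)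
Lemma gap_le (n : int) : 0 < A -> gap lam n <= B / A + 2.
Proof.
move=> A0; rewrite leNgt; apply/negP => hg.
set g := gap lam n in hg *.
(* The midpoint of the gap: all points of the spectrum lie at distance at least g/2 from it. *)
set m := lam n - g / 2.
have p0 : 0 < pi ^+ 2 :> R by rewrite exprn_gt0// pi_gt0.
have B0 : 0 < B.
  have /andP[h1 h2] := frame 0.
  by apply: lt_le_trans A0 _; rewrite -lee_fin; exact: le_trans h1 h2.
have g2 : 2 < g by have := divr_gt0 B0 A0; lra.
have right k : n <= k -> g / 2 <= lam k - m.
  move=> nk; suff : lam n <= lam k by rewrite /m; lra.
  by move: nk; rewrite le_eqVlt => /predU1P[->//|/lam_incr/ltW].
have left k : k < n -> g / 2 <= m - lam k.
  move=> kn; suff : lam k <= lam (n - 1) by rewrite /m /g /gap; lra.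
  have : k <= n - 1 by rewrite -ltzD1 subrK.
  by rewrite le_eqVlt => /predU1P[->//|/lam_incr/ltW].
(* Here [q] is the distance to [m]: lam k - m on the right, m - lam k on the left. *)
have side (q : int -> R) (s : seq int) : uniq s ->
    (forall y t, uniq t -> {in t, forall k, y <= q k <= y + 1} ->
      (size t)%:R <= B * pi ^+ 2 / 4) ->
    {in s, forall k, g / 2 <= q k} ->
    \sum_(k <- s) q k ^- 2 <= B * pi ^+ 2 / 4 * (g / 2 - 1)^-1.
  move=> us hC hs.
  set J := (Num.truncn (\sum_(k <- s) `|q k|)).+1.
  have hs' : {in s, forall k, g / 2 <= q k < g / 2 + J%:R}.
    move=> k ks; rewrite hs//=; suff : q k < J%:R by lra.
    apply: le_lt_trans (truncnS_gt _); rewrite (big_rem k)//=.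
    by rewrite (le_trans (ler_norm _))// lerDl sumr_ge0.
  apply: (le_trans (@sum_le_unit_blocks R _ (fun y => y ^- 2) q _ (g / 2) J s hC
    _ _ us hs')) => [y _|y z gy yz|].
  - by rewrite invr_ge0 sqr_ge0.
  - by rewrite lef_pV2 ?posrE ?exprn_gt0 ?ler_pXn2r ?nnegrE//; lra.
  - rewrite ler_wpM2l//; first by rewrite ltW// divr_gt0// mulr_gt0.
    by apply: inv_sqr_sum_le; lra.
have : A <= B / (g - 2).
  have /andP[h _] := frame m; rewrite -lee_fin (le_trans h)// => {h}.
  (* The infinite sum is the supremum of its finite partial sums, so a uniform bound on these
     suffices. *)
  apply: ge_ereal_sup => _ [X [finX _] <-].
  rewrite fsbig_finite//= sumEFin lee_fin.
  set s := finmap.enum_fset _.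
  have us : uniq s by exact: finmap.fset_uniq.
  have lamm k : lam k != m.
    by apply/eqP => e; case: (leP n k) => [/right|/left]; lra.
  apply: (@le_trans _ _ (pi ^- 2 * \sum_(k <- s) (lam k - m) ^- 2)).
    by rewrite mulr_sumr ler_sum// => k _; exact: fourier_coeff_expi_le.
  rewrite (bigID (fun k => n <= k)) -[X in _ * (X + _)]big_filter.
  rewrite -[X in _ * (_ + X)]big_filter /=.
  have H1 : \sum_(k <- [seq k <- s | n <= k]) (lam k - m) ^- 2 <=
      B * pi ^+ 2 / 4 * (g / 2 - 1)^-1.
    apply: side; first by rewrite filter_uniq.
      move=> y t ut ht; apply: (@card_unit_interval (y + m)) => // k /ht; lra.
    by move=> k; rewrite mem_filter => /andP[/right].
  have H2 : \sum_(k <- [seq k <- s | ~~ (n <= k)]) (lam k - m) ^- 2 <=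
      B * pi ^+ 2 / 4 * (g / 2 - 1)^-1.
    under eq_bigr do rewrite -opprB sqrrN.
    apply: side; first by rewrite filter_uniq.
      (* Reflection at [m] sends [y, y + 1] to [m - y - 1, m - y]. *)
      move=> y t ut ht; apply: (@card_unit_interval (m - y - 1)) => // k /ht; lra.
    by move=> k; rewrite mem_filter -ltNge => /andP[/left].
  rewrite mulrC ler_pdivrMr//; apply: le_trans (lerD H1 H2) _.
  rewrite le_eqVlt; apply/orP; left; apply/eqP; field; lra.
rewrite ler_pdivlMr; last lra.
have := hg; rewrite -ltrBrDr ltr_pdivrMr//; lra.
Qed.

End Gap_bounds.

(** * Passage to the extended suprema *)

Theorem theorem1p5 (R : realType) (lam : int -> R) (A B : R)
  (lam_incr : forall n m : int, n < m -> lam n < lam m)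
  (A_gt0 : 0 < A) (A_le_B : A <= B)
  (frame : forall f : R -> R[i], inL2 `[0, 1] f ->
     (A%:E * sqnorm2 `[0%R, 1%R] f
        <= \esum_(l in range lam) (cabs (fourier_coeff f l) ^+ 2)%R%:E)%E /\
     (\esum_(l in range lam) (cabs (fourier_coeff f l) ^+ 2)%R%:E
        <= B%:E * sqnorm2 `[0%R, 1%R] f)%E) :
  [/\ ((4 / (pi ^+ 2 * B))%R%:E <= gmax lam)%E,
      (gmax lam <= gap_sup lam)%E &
      (gap_sup lam <= (pi ^+ 2 * B / A + 2)%R%:E)%E].
Proof.
have B_gt0 : 0 < B := lt_le_trans A_gt0 A_le_B.
have frame' := frame_expi _ _ _ _ lam_incr frame.
have M_gt0 : 0 < 4 / (pi ^+ 2 * B) by rewrite divr_gt0// mulr_gt0// exprn_gt0// pi_gt0.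
split.
(* Infinitely many gaps exceed c only for c strictly below the constant, hence the loss of [e]. If
   [e] exceeds the constant, c = 0 serves, as [gmax] admits only c >= 0. *)
- apply/lee_subgt0Pr => e e0.
  have [le_eM|lt_Me] := leP e (4 / (pi ^+ 2 * B)).
    apply: ereal_sup_ubound; exists (4 / (pi ^+ 2 * B) - e) => //.
    split; first by rewrite subr_ge0.
    by apply: infinite_large_gaps frame' _ _ _ _ => //; lra.
  apply: (@le_trans _ _ 0%:E); first by rewrite -EFinB lee_fin; lra.
  apply: ereal_sup_ubound; exists 0 => //; split => //.
  exact: infinite_large_gaps frame' _ _ _ _.
- apply: ge_ereal_sup => _ [c [c0 inf_c] <-].
  have [k /= ck] : [set k | c < gap lam k] !=set0 by exact: infinite_setN0.
  by apply: ereal_sup_ge; exists (gap lam k)%:E; [exists k|rewrite lee_fin ltW].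
- apply: ge_ereal_sup => _ [k _ <-]; rewrite lee_fin.
  apply: le_trans (gap_le _ _ _ lam_incr frame' k A_gt0) _.
  (* The bound B/A + 2 is weakened using pi^2 >= 1. *)
  rewrite lerD2r ler_pM2r ?invr_gt0// ler_peMl ?(ltW B_gt0)//.
  by have := @pi_ge2 R; nra.
Qed.
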